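(* Let $p=3$. There exist unique elements $q_0\equiv 7\pmod 9$ and $q_1\equiv 4\pmod 9$ in $U^{(1)}-U^{(2)}$ such that $\iota_{q_0}$ and $\iota_{q_1}$ have no nontrivial $3$-adic fixed points. If $q\in U^{(1)}-U^{(2)}$ and $q\notin\{q_0,q_1\}$, then $\iota_q$ has a unique nontrivial $3$-adic fixed point $z_q\in\mathbb{Z}_3$. For such $q$: if $q\in 4+9\mathbb{Z}_3$ then $z_q\in 1+3\mathbb{Z}_3$, and if $q\in 7+9\mathbb{Z}_3$ then $z_q\in 3\mathbb{Z}_3$.
   Context: $\mathbb{Z}_3$ is the ring of $3$-adic integers, $U^{(m)}=1+3^m\mathbb{Z}_3$, so $U^{(1)}-U^{(2)}=(4+9\mathbb{Z}_3)\cup(7+9\mathbb{Z}_3)$. For $q\in U^{(1)}$, $\iota_q:\mathbb{Z}_3\to\mathbb{Z}_3$ is the unique continuous function with $\iota_q(n)=1+q+\cdots+q^{n-1}$ for all integers $n\ge 0$; thus $\iota_q(z)=(q^z-1)/(q-1)$ for $q\ne 1$. A $3$-adic fixed point of $\iota_q$ is $z\in\mathbb{Z}_3$ with $\iota_q(z)=z$; the fixed points $0$ and $1$ (which every $\iota_q$ has) are called trivial, and all others nontrivial. *)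

(* Defs.v *)
From HB Require Import structures.
From mathcomp Require Import all_boot all_order all_algebra.
From mathcomp Require Import boolp classical_sets functions filter topology.
From mathcomp Require Import zify.

Set Implicit Arguments.
Unset Strict Implicit.
Unset Printing Implicit Defensive.

Import GRing.Theory.
Local Open Scope classical_set_scope.
Local Open Scope ring_scope.

(** * The ring of 3-adic integers *)

(* The inverse limit of the rings Z/3^n: an element is the coherent sequence
   of its residues modulo 3^n, each represented by a natural number; the
   coherence condition forces [residue n < 3 ^ n]. *)
Record Z3 := MkZ3 {
  residue :> nat -> nat;
  residueS : forall n, residue n = (residue n.+1 %% 3 ^ n)%N }.

HB.instance Definition _ := gen_eqMixin Z3.
HB.instance Definition _ := gen_choiceMixin Z3.

Lemma Z3P (x y : Z3) : (forall n, x n = y n) -> x = y.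
Proof.
case: x y => [x xP] [y yP] /= /funext exy; move: xP; rewrite exy => xP.
by congr MkZ3; exact: Prop_irrelevance.
Qed.

Lemma residue_lt (x : Z3) n : (x n < 3 ^ n)%N.
Proof. by rewrite residueS ltn_mod expn_gt0. Qed.

Lemma residue_mod (x : Z3) m n : (m <= n)%N -> (x n %% 3 ^ m)%N = x m.
Proof.
move=> /subnK <-; elim: (n - m)%N => [|k <-].
  by rewrite add0n modn_small ?residue_lt.
by rewrite addSn (residueS x (k + m)) modn_dvdm // dvdn_exp2l // leq_addl.
Qed.

Lemma modn3S a n : (a %% 3 ^ n.+1 %% 3 ^ n)%N = (a %% 3 ^ n)%N.
Proof. by rewrite modn_dvdm // dvdn_exp2l. Qed.

Fact add_subproof (x y : Z3) n :
  ((x n + y n) %% 3 ^ n = (x n.+1 + y n.+1) %% 3 ^ n.+1 %% 3 ^ n)%N.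
Proof. by rewrite modn3S (residueS x n) (residueS y n) modnDm. Qed.

Fact mul_subproof (x y : Z3) n :
  ((x n * y n) %% 3 ^ n = (x n.+1 * y n.+1) %% 3 ^ n.+1 %% 3 ^ n)%N.
Proof. by rewrite modn3S (residueS x n) (residueS y n) modnMm. Qed.

Fact opp_subproof (x : Z3) n :
  ((3 ^ n - x n) %% 3 ^ n = (3 ^ n.+1 - x n.+1) %% 3 ^ n.+1 %% 3 ^ n)%N.
Proof.
rewrite modn3S; apply/eqP; rewrite -(eqn_modDr (x n)).
rewrite subnK ?(ltnW (residue_lt _ _)) // modnn [X in (_ + X)%N]residueS modnDmr.
by rewrite subnK ?(ltnW (residue_lt _ _)) // expnS modnMl.
Qed.

Fact nat_subproof (k n : nat) : (k %% 3 ^ n = k %% 3 ^ n.+1 %% 3 ^ n)%N.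
Proof. by rewrite modn3S. Qed.

Definition Z3_nat (k : nat) : Z3 := MkZ3 (nat_subproof k).
Definition Z3_add (x y : Z3) : Z3 := MkZ3 (add_subproof x y).
Definition Z3_mul (x y : Z3) : Z3 := MkZ3 (mul_subproof x y).
Definition Z3_opp (x : Z3) : Z3 := MkZ3 (opp_subproof x).

Fact Z3_addA : associative Z3_add.
Proof. by move=> x y z; apply: Z3P => n /=; rewrite modnDmr modnDml addnA. Qed.
Fact Z3_addC : commutative Z3_add.
Proof. by move=> x y; apply: Z3P => n /=; rewrite addnC. Qed.
Fact Z3_add0 : left_id (Z3_nat 0) Z3_add.
Proof.
by move=> x; apply: Z3P => n /=; rewrite mod0n add0n modn_small ?residue_lt.
Qed.
Fact Z3_addN : left_inverse (Z3_nat 0) Z3_opp Z3_add.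
Proof.
move=> x; apply: Z3P => n /=; rewrite modnDml subnK ?(ltnW (residue_lt _ _)) //.
by rewrite modnn mod0n.
Qed.
Fact Z3_mulA : associative Z3_mul.
Proof. by move=> x y z; apply: Z3P => n /=; rewrite modnMmr modnMml mulnA. Qed.
Fact Z3_mulC : commutative Z3_mul.
Proof. by move=> x y; apply: Z3P => n /=; rewrite mulnC. Qed.
Fact Z3_mul1 : left_id (Z3_nat 1) Z3_mul.
Proof.
by move=> x; apply: Z3P => n /=; rewrite modnMml mul1n modn_small ?residue_lt.
Qed.
Fact Z3_mulD : left_distributive Z3_mul Z3_add.
Proof.
by move=> x y z; apply: Z3P => n /=; rewrite modnMml modnDm mulnDl.
Qed.
Fact Z3_1neq0 : Z3_nat 1 != Z3_nat 0.
Proof. by apply/eqP => /(congr1 (fun x : Z3 => x 1)). Qed.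

HB.instance Definition _ :=
  GRing.isZmodule.Build Z3 Z3_addA Z3_addC Z3_add0 Z3_addN.
HB.instance Definition _ :=
  GRing.Zmodule_isComNzRing.Build Z3 Z3_mulA Z3_mulC Z3_mul1 Z3_mulD Z3_1neq0.

Lemma residueD (x y : Z3) n : (x + y) n = ((x n + y n) %% 3 ^ n)%N.
Proof. by []. Qed.
Lemma residueM (x y : Z3) n : (x * y) n = ((x n * y n) %% 3 ^ n)%N.
Proof. by []. Qed.
Lemma residue_nat k n : (k%:R : Z3) n = (k %% 3 ^ n)%N.
Proof.
elim: k => [//|k IHk]; rewrite -addn1 natrD residueD IHk.
by rewrite (_ : (1%:R : Z3) n = 1 %% 3 ^ n)%N // modnDm.
Qed.
Lemma residueX (x : Z3) k n : (x ^+ k) n = (x n ^ k %% 3 ^ n)%N.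
Proof.
elim: k => [|k IHk]; first by rewrite expr0 expn0.
by rewrite exprS residueM IHk modnMmr -expnS.
Qed.
Lemma residue_sum (F : nat -> Z3) k n :
  (\sum_(i < k) F i) n = ((\sum_(i < k) F i n) %% 3 ^ n)%N.
Proof.
elim: k => [|k IHk]; first by rewrite !big_ord0.
by rewrite big_ord_recr residueD [X in (X + _)%N]IHk modnDml big_ord_recr.
Qed.

(** * Congruence classes and the 3-adic topology *)

(* The coset a + m Z_3. *)
Definition coset (a m : Z3) : set Z3 := [set a + m * z | z in [set: Z3]].

Lemma coset_residue (x y : Z3) n : coset x (3 ^+ n) y <-> y n = x n.
Proof.
split=> [[z _ <-]|exy].
  rewrite residueD residueM residueX residue_nat.
  by rewrite modnXm modnn mul0n mod0n addn0 modn_small ?residue_lt.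
pose d : Z3 := y - x.
have dn0 : d n = 0%N.
  by rewrite residueD exy -residueD subrr (residue_nat 0) mod0n.
have divd m : (3 ^ n * (d (n + m) %/ 3 ^ n) = d (n + m))%N.
  by rewrite mulnC divnK // /dvdn (residue_mod d (leq_addr _ _)) dn0.
have zP m : (d (n + m) %/ 3 ^ n = d (n + m.+1) %/ 3 ^ n %% 3 ^ m)%N.
  apply/eqP; rewrite -(eqn_pmul2l (_ : 0 < 3 ^ n)%N) ?expn_gt0 //.
  by rewrite divd muln_modr divd -expnD residue_mod // addnS.
exists (MkZ3 zP) => //; have -> : y = x + d by rewrite addrC subrK.
congr (x + _); apply: Z3P => m.
rewrite residueM residueX residue_nat modnXm modnMml.
by rewrite divd residue_mod ?leq_addl.
Qed.

(* The neighbourhoods of x are the sets containing x + 3^n Z_3 for some n. *)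
HB.instance Definition _ := hasNbhs.Build Z3
  (fun x => filter_from [set: nat] (fun n => coset x (3 ^+ n))).

Fact Z3_nbhs_filter (x : Z3) : ProperFilter (nbhs x).
Proof.
apply: filter_from_proper; last by move=> n _; exists x; apply/coset_residue.
apply: filter_from_filter; first by exists 0%N.
move=> m n _ _; exists (maxn m n) => // y /coset_residue exy.
by split; apply/coset_residue; rewrite -(residue_mod y (n := maxn m n))
  ?leq_maxl ?leq_maxr // exy residue_mod ?leq_maxl ?leq_maxr.
Qed.
Fact Z3_nbhs_singleton (x : Z3) (A : set Z3) : nbhs x A -> A x.
Proof. by move=> [n _]; apply; apply/coset_residue. Qed.
Fact Z3_nbhs_nbhs (x : Z3) (A : set Z3) : nbhs x A -> nbhs x (nbhs^~ A).
Proof.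
move=> [n _ nA]; exists n => // y /coset_residue exy; exists n => // z.
by move=> /coset_residue ezy; apply/nA/coset_residue; rewrite ezy.
Qed.
HB.instance Definition _ := Nbhs_isNbhsTopological.Build Z3
  Z3_nbhs_filter Z3_nbhs_singleton Z3_nbhs_nbhs.

(** * The functions iota_q and their fixed points *)

(* U^(m) = 1 + 3^m Z_3. *)
Definition U (m : nat) : set Z3 := coset 1 (3 ^+ m).

Definition q_interpolation (q : Z3) (f : Z3 -> Z3) : Prop :=
  continuous f /\ forall n : nat, f n%:R = \sum_(i < n) q ^+ i.

(* For q in U^(1), iota_q is the unique continuous f : Z_3 -> Z_3 such that
   f n = 1 + q + ... + q^(n-1) for all n; see [iota_q_unique] below.  The
   value for other q is irrelevant. *)
Definition iota_q (q : Z3) : Z3 -> Z3 := xget (id : Z3 -> Z3) (q_interpolation q).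

Lemma continuousZ3P (f : Z3 -> Z3) :
  continuous f <->
  forall (x : Z3) n, exists m, forall y : Z3, y m = x m -> f y n = f x n.
Proof.
split=> [cf x n|cf x A [n _ nA]].
  have /cf [m _ mA] : nbhs (f x) (coset (f x) (3 ^+ n)) by exists n.
  by exists m => y exy; apply/coset_residue/mA/coset_residue.
have [m mP] := cf x n; exists m => // y /coset_residue exy.
by apply/nA/coset_residue/mP.
Qed.

Lemma dvdn_geometric_sum a n :
  a = 1 %[mod 3] -> (3 ^ n %| \sum_(i < 3 ^ n) a ^ i)%N.
Proof.
move=> a1; elim: n => [|n IHn]; first by rewrite dvd1n.
have splitS k l : (\sum_(i < k + l) a ^ i =
    \sum_(i < k) a ^ i + a ^ k * \sum_(i < l) a ^ i)%N.
  rewrite big_split_ord /= big_distrr /=; congr (_ + _)%N.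
  by apply: eq_bigr => i _; rewrite expnD.
rewrite expnS (_ : 3 * 3 ^ n = 3 ^ n + (3 ^ n + 3 ^ n))%N; last by lia.
set N := (3 ^ n)%N in IHn *; rewrite !splitS; set S := (\sum_(i < N) _)%N in IHn *.
have -> : (S + a ^ N * (S + a ^ N * S) = (1 + a ^ N + a ^ N * a ^ N) * S)%N by lia.
rewrite (_ : N + (N + N) = 3 * N)%N; last by lia.
apply: dvdn_mul => //; set b := (a ^ N)%N.
have b1 : b = 1 %[mod 3] by rewrite /b -modnXm a1 exp1n.
have -> : b = (b %/ 3 * 3 + 1)%N by rewrite {1}(divn_eq b 3) b1.
by apply/dvdnP; exists ((b %/ 3) * (b %/ 3) * 3 + (b %/ 3) * 3 + 1)%N; lia.
Qed.

Lemma geometric_sum_mod a n k l : a = 1 %[mod 3] -> k = l %[mod 3 ^ n] ->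
  (\sum_(i < k) a ^ i = \sum_(i < l) a ^ i %[mod 3 ^ n])%N.
Proof.
move=> a1; wlog lekl : k l / (k <= l)%N => [hw|].
  by case/orP: (leq_total k l) => h e; [|symmetry]; exact: hw.
move=> /esym/eqP; rewrite eqn_mod_dvd // => /dvdnP[c].
move=> /eqP; rewrite -(eqn_add2r k) subnK // => /eqP ->.
elim: c => [|c IHc]; first by rewrite mul0n.
rewrite mulSn -addnA addnC big_split_ord /=.
under [X in (_ + X)%N]eq_bigr do rewrite expnD.
rewrite -big_distrr /= -modnDmr -modnMmr.
by rewrite (eqP (dvdn_geometric_sum n a1)) muln0 mod0n addn0.
Qed.

Lemma U1_mod3 (q : Z3) n : U 1 q -> (0 < n)%N -> q n = 1 %[mod 3].
Proof.
move=> /coset_residue q1 n_gt0.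
by rewrite -[3%N]expn1 (residue_mod q n_gt0) q1 (residue_nat 1).
Qed.

Lemma iota_q_unique (q : Z3) : U 1 q -> unique (q_interpolation q) (iota_q q).
Proof.
move=> Uq; have q1 n : q n.+1 = 1 %[mod 3] by exact: U1_mod3.
pose h (z : Z3) n := ((\sum_(i < z n) q n ^ i) %% 3 ^ n)%N.
have hk k n : h k%:R n = (\sum_(i < k) q ^+ i) n.
  rewrite residue_sum /h; case: n => [|n]; first by rewrite !modn1.
  rewrite residue_nat (geometric_sum_mod (q1 n) (modn_mod _ _)).
  by under [in RHS]eq_bigr do rewrite residueX; rewrite modn_summ.
have hP z n : h z n = (h z n.+1 %% 3 ^ n)%N.
  case: n => [|n]; rewrite /h; first by rewrite !modn1.
  rewrite modn3S -[in RHS]modn_summ.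
  under [in RHS]eq_bigr do rewrite -modnXm -residueS.
  rewrite modn_summ; apply: geometric_sum_mod => //.
  by rewrite (residueS z) modn_mod.
have f_ok : q_interpolation q (fun z => MkZ3 (hP z)).
  split=> [|k]; last by apply: Z3P => n; exact: hk.
  by apply/continuousZ3P => x n; exists n => y /= exy; rewrite /h exy.
have uniq_f f g : q_interpolation q f -> q_interpolation q g -> f = g.
  move=> [/continuousZ3P cf fn] [/continuousZ3P cg gn]; apply/funext => z.
  apply: Z3P => n; have [k kP] := cf z n; have [l lP] := cg z n.
  have zE m : (m <= maxn k l)%N -> ((z (maxn k l))%:R : Z3) m = z m.
    by move=> lem; rewrite residue_nat residue_mod.
  by rewrite -(kP _ (zE _ (leq_maxl _ _))) -(lP _ (zE _ (leq_maxr _ _))) fn gn.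
split=> [|g g_ok]; first exact: xgetI f_ok.
by apply: uniq_f => //; exact: xgetI f_ok.
Qed.

Definition fixed_point (f : Z3 -> Z3) (z : Z3) : Prop := f z = z.

Definition nontrivial_fixed_point (q z : Z3) : Prop :=
  [/\ fixed_point (iota_q q) z, z <> 0 & z <> 1].

(* Main.v *)
Require Import Defs.
From mathcomp Require Import all_boot all_order all_algebra.
From mathcomp Require Import boolp classical_sets functions filter topology.
From mathcomp Require Import ring zify.

Import GRing.Theory.
Local Open Scope classical_set_scope.
Local Open Scope ring_scope.

(** Write q = 1 + 3u.  The binomial expansion of iota_q gives
      2 (iota_q z - z) = z (z - 1) 3u G(u, z),
      G(u, z) = sum_(j >= 0) d_j u^j (z - 2) ... (z - j - 1),
    with d_j = 2 * 3^j / (j + 2)!.  As 3^(floor (j / 2)) divides d_j, the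
    series converges and G(u, z) = 1 + u (z - 2) + 3 K(u, z) with K integral
    and 1-Lipschitz.  For u a unit, Hensel's lemma in z yields exactly one root
    z_q of G(u, -), congruent to 2 - 1/u mod 3; it is the only possible
    nontrivial fixed point.  So there is none exactly when z_q is 0 or 1, that
    is when G(u, 0) = 0 (forcing u = 2 mod 3) or G(u, 1) = 0 (forcing
    u = 1 mod 3), and Hensel's lemma in u shows that each of these two equations
    has exactly one root. *)

(** * Congruences modulo powers of 3 *)

Lemma residue0 n : (0 : Z3) n = 0%N.
Proof. by rewrite (residue_nat 0) mod0n. Qed.

Lemma residue_level0 (x : Z3) : x 0%N = 0%N.
Proof. by have := residue_lt x 0; case: (x 0%N). Qed.

Lemma residue_le (x y : Z3) m n : (m <= n)%N -> x n = y n -> x m = y m.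
Proof. by move=> lemn exy; rewrite -(residue_mod x lemn) exy residue_mod. Qed.

Lemma eqrD (x x' y y' : Z3) n :
  x n = x' n -> y n = y' n -> (x + y) n = (x' + y') n.
Proof. by move=> ex ey; rewrite !residueD ex ey. Qed.

Lemma eqrM (x x' y y' : Z3) n :
  x n = x' n -> y n = y' n -> (x * y) n = (x' * y') n.
Proof. by move=> ex ey; rewrite !residueM ex ey. Qed.

Lemma eqrX (x x' : Z3) k n : x n = x' n -> (x ^+ k) n = (x' ^+ k) n.
Proof. by move=> ex; rewrite !residueX ex. Qed.

Lemma eqr_sum (F F' : nat -> Z3) k n : (forall i, (i < k)%N -> F i n = F' i n) ->
  (\sum_(i < k) F i) n = (\sum_(i < k) F' i) n.
Proof.
move=> eF; rewrite !residue_sum; congr (_ %% _)%N.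
by apply: eq_bigr => i _; exact: eF.
Qed.

Lemma eqr_prod (F F' : nat -> Z3) k n : (forall i, (i < k)%N -> F i n = F' i n) ->
  (\prod_(i < k) F i) n = (\prod_(i < k) F' i) n.
Proof.
elim: k => [|k IHk] eF; first by rewrite !big_ord0.
rewrite !big_ord_recr /=; apply: eqrM; last exact: eF.
by apply: IHk => i ltik; apply: eF; exact: ltnW.
Qed.

Lemma residue_dvdP (x y : Z3) n : y n = x n <-> exists t, y = x + 3 ^+ n * t.
Proof.
split=> [/coset_residue[t _ <-]|[t ->]]; first by exists t.
by apply/coset_residue; exists t.
Qed.

Lemma residue_eq0P (x : Z3) n : x n = 0%N <-> exists t, x = 3 ^+ n * t.
Proof.
have := residue_dvdP 0 x n; rewrite residue0 => -[H1 H2]; split=> [/H1|] [t xE].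
  by exists t; rewrite xE add0r.
by apply: H2; exists t; rewrite xE add0r.
Qed.

Lemma eqrM3 (x y : Z3) n : x n = y n -> (3 * x) n.+1 = (3 * y) n.+1.
Proof.
by move=> /residue_dvdP[t ->]; apply/residue_dvdP; exists t; rewrite exprS; ring.
Qed.

Lemma mul3_eq0 (x : Z3) : 3 * x = 0 -> x = 0.
Proof.
move=> x30; apply: Z3P => n; rewrite residue0.
have : (3 * x) n.+1 = 0%N by rewrite x30 residue0.
rewrite residueM residue_nat modnMml expnS -muln_modr => /eqP.
by rewrite muln_eq0 /= -residueS => /eqP.
Qed.

Lemma mul3X_eq0 k (x : Z3) : 3 ^+ k * x = 0 -> x = 0.
Proof.
elim: k => [|k IHk]; first by rewrite mul1r.
by rewrite exprS -mulrA => /mul3_eq0.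
Qed.

(** * Contractions and Hensel's lemma *)

(** All points agree at level 0 and each application of [F] gains one level, so the [n]-th iterate
    modulo 3^n does not depend on the starting point. These residues are coherent and form the
    limit. *)
Lemma contraction_fixed_point (F : Z3 -> Z3) :
  (forall n (x y : Z3), x n = y n -> F x n.+1 = F y n.+1) ->
  exists! z, F z = z.
Proof.
move=> cF.
have itF n x y : iter n F x n = iter n F y n.
  elim: n => [|n IHn] /=; first by rewrite !residue_level0.
  exact: cF.
have zP n : iter n F 0 n = (iter n.+1 F 0%R n.+1 %% 3 ^ n)%N.
  by rewrite -residueS iterSr; exact: itF.
exists (MkZ3 zP); split=> [|y Fy].
  by apply: Z3P => -[|n]; [rewrite !residue_level0 | exact: cF].
apply: Z3P => n /=; rewrite -[in RHS](_ : iter n F y = y); first exact: itF.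
by elim: n => //= n ->.
Qed.

(** The hypothesis says that [f] has slope [e] up to a term that gains a level. As [e] is its own
    inverse, the Newton step x - e f(x) equals -e (f(x) - e x), a contraction whose fixed points are
    the roots of [f]. *)
Lemma hensel (f : Z3 -> Z3) (e : Z3) : e * e = 1 ->
  (forall n (x y : Z3), x n = y n -> (f x - e * x) n.+1 = (f y - e * y) n.+1) ->
  exists! z, f z = 0.
Proof.
move=> e2 cf.
have [n x y exy|z [Fz zU]] := contraction_fixed_point (fun x => x - e * f x).
  have FE w : w - e * f w = - e * (f w - e * w).
    by rewrite -[X in X - _]mul1r -e2; ring.
  by rewrite !FE; apply: eqrM => //; exact: cf.
exists z; split=> [|y fy]; last by apply: zU; rewrite fy mulr0 subr0.
have /(congr1 (fun w => e * (z - w))) : z - e * f z = z by [].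
by rewrite subrr mulr0 opprB addrC subrK mulrA e2 mul1r.
Qed.

(** * Units and absence of zero divisors *)

(** The sign 1 or -1 congruent to [u] modulo 3 serves as the slope in [hensel]. *)
Lemma unit_sign (u : Z3) : u 1%N <> 0%N ->
  exists e : Z3, e * e = 1 /\ u 1%N = e 1%N.
Proof.
move=> u0; have := residue_lt u 1.
case u1: (u 1%N) => [|[|[|]]] // _; first by exists 1; rewrite mul1r.
by exists (-1); split; [ring | done].
Qed.

Lemma unit_inverse (u : Z3) : u 1%N <> 0%N -> exists v, u * v = 1.
Proof.
move=> /unit_sign[e [e2 /residue_dvdP[t uE]]].
have [n x y exy|v [/eqP]] := hensel (fun x => u * x - 1) e e2.
  have fE w : u * w - 1 - e * w = 3 * (t * w) - 1 by rewrite uE; ring.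
  by rewrite !fE; apply: eqrD => //; apply: eqrM3; exact: eqrM.
by rewrite subr_eq0 => /eqP vE _; exists v.
Qed.

(** Induction on a level at which [x] is nonzero: dividing by 3 lowers that level by one. *)
Lemma Z3_factor (x : Z3) : x <> 0 ->
  exists k v, x = 3 ^+ k * v /\ v 1%N <> 0%N.
Proof.
move=> x0; have [n xn] : exists n, x n != 0%N.
  apply: contrapT => nx; apply: x0; apply: Z3P => n; rewrite residue0.
  by apply/eqP/negPn/negP => xn; apply: nx; exists n.
elim: n x {x0} xn => [|n IHn] x xn; first by rewrite residue_level0 in xn.
have [x1|x1] := eqVneq (x 1%N) 0%N; last first.
  by exists 0%N, x; rewrite mul1r; split=> //; exact/eqP.
have /residue_eq0P[y xE] := x1.
have [|k [v [yE v1]]] := IHn y.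
  apply: contraNneq xn => yn; apply/eqP; rewrite xE expr1.
  by have := @eqrM3 y 0 n; rewrite mulr0 !residue0; apply.
by exists k.+1, v; rewrite xE yE mulrA -exprD add1n.
Qed.

Lemma Z3_mulI (x y : Z3) : x * y = 0 -> x <> 0 -> y = 0.
Proof.
move=> xy /Z3_factor[k [v [xE /unit_inverse[w vw]]]].
apply: (@mul3X_eq0 k); have -> : 3 ^+ k * y = 3 ^+ k * y * (v * w).
  by rewrite vw mulr1.
have -> : 3 ^+ k * y * (v * w) = w * (x * y) by rewrite xE; ring.
by rewrite xy mulr0.
Qed.

(** * The coefficients d_j *)

Lemma logn3_fact n : (0 < n)%N -> (2 * logn 3 n`! < n)%N.
Proof.
move=> n0; rewrite logn_fact //.
(* Legendre's formula is bounded by telescoping: three times the next quotient is at most the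
   current one. The [maxn 1] keeps the final inequality strict once the quotients vanish. *)
suff H K : (2 * \sum_(1 <= k < K.+1) n %/ 3 ^ k + maxn 1 (n %/ 3 ^ K) <= n)%N.
  by have := H n; lia.
elim: K => [|K IHK]; first by rewrite big_geq // expn0 divn1; lia.
rewrite big_nat_recr //= expnSr divnMA; lia.
Qed.

(** Write (j + 2)! = m 3^v with [m] prime to 3 and invert [m]. Since 2v < j + 2, the exponent j - v
    is at least floor(j / 2). *)
Lemma Gcoef_exists j : exists d : Z3,
  d * ((j + 2)`!)%:R = 2 * 3 ^+ j /\ exists t, d = 3 ^+ j./2 * t.
Proof.
have j0 : (0 < (j + 2)`!)%N by exact: fact_gt0.
have := @logn3_fact (j + 2); rewrite addn2 => /(_ isT) vj.
have [m m3 jE] := pfactor_coprime (isT : prime 3) j0; rewrite addn2 in jE *.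
set v := logn 3 _ in vj jE.
have [|w mw] := unit_inverse (m%:R).
  by rewrite residue_nat expn1; apply/eqP; rewrite -/(3 %| m)%N -prime_coprime.
have [lt1 lt2] : (v <= j)%N /\ (j./2 <= j - v)%N by lia.
exists (2 * w * 3 ^+ (j - v)); split.
  rewrite jE natrM natrX -{2}(subnK lt1) exprD.
  rewrite -[RHS]mulr1 -[X in _ = _ * X]mw; ring.
exists (2 * w * 3 ^+ (j - v - j./2)).
by rewrite -{1}(subnK lt2) exprD; ring.
Qed.

Definition Gcoef (j : nat) : Z3 := projT1 (cid (Gcoef_exists j)).

Lemma GcoefE j : Gcoef j * ((j + 2)`!)%:R = 2 * 3 ^+ j.
Proof. by rewrite /Gcoef; case: cid => d []. Qed.

Lemma Gcoef_dvd j : exists t, Gcoef j = 3 ^+ j./2 * t.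
Proof. by rewrite /Gcoef; case: cid => d []. Qed.

Lemma Gcoef_residue0 n j : (n.*2 <= j)%N -> Gcoef j n = 0%N.
Proof.
move=> lenj; have [t ->] := Gcoef_dvd j; apply/residue_eq0P.
exists (3 ^+ (j./2 - n) * t); rewrite mulrA -exprD subnKC //; lia.
Qed.

Lemma half_exists : exists h : Z3, 2 * h = 1.
Proof. by apply: unit_inverse; rewrite residue_nat. Qed.

Lemma mul2_eq0 (x : Z3) : 2 * x = 0 -> x = 0.
Proof.
move=> x20; have [h h2] := half_exists.
by rewrite -[x]mul1r -[X in X * _]h2 mulrAC x20 mul0r.
Qed.

Lemma Gcoef0 : Gcoef 0 = 1.
Proof.
apply/eqP; rewrite -subr_eq0; apply/eqP/mul2_eq0.
have := GcoefE 0; rewrite mulr1 (_ : ((0 + 2)`!)%:R = 2 :> Z3) // => e2.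
by rewrite mulrBr mulrC e2 mulr1 subrr.
Qed.

Lemma Gcoef1 : Gcoef 1 = 1.
Proof.
apply/eqP; rewrite -subr_eq0; apply/eqP/mul2_eq0/mul3_eq0.
have := GcoefE 1; rewrite expr1 (_ : ((1 + 2)`!)%:R = 2 * 3 :> Z3); last first.
  by rewrite -natrM.
move=> e2.
have -> : 3 * (2 * (Gcoef 1 - 1)) = Gcoef 1 * (2 * 3) - 2 * 3 by ring.
by rewrite e2 subrr.
Qed.

(** * The series G *)

Definition Gterm (u z : Z3) (j : nat) : Z3 :=
  Gcoef j * u ^+ j * \prod_(i < j) (z - 2 - i%:R).

Lemma Gterm_residue0 u z n j : (n.*2 <= j)%N -> Gterm u z j n = 0%N.
Proof.
by move=> /Gcoef_residue0 cj; rewrite /Gterm -mulrA residueM cj mul0n mod0n.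
Qed.

Lemma sum_Gterm_residue u z n m N : (n <= m)%N -> (n.*2 <= N)%N ->
  ((\sum_(j < N) Gterm u z j)%R m %% 3 ^ n)%N = (\sum_(j < n.*2) Gterm u z j) n.
Proof.
move=> lenm leN; rewrite residue_mod // -(subnKC leN).
elim: (N - _)%N => [|k IHk]; first by rewrite addn0.
rewrite addnS big_ord_recr residueD IHk Gterm_residue0 ?leq_addr //.
by rewrite addn0 modn_small ?residue_lt.
Qed.

Fact G_subproof u z n : (\sum_(j < n.*2) Gterm u z j) n =
  ((\sum_(j < n.+1.*2) Gterm u z j)%R n.+1 %% 3 ^ n)%N.
Proof. by rewrite sum_Gterm_residue // leq_double. Qed.

(* At level n only the terms with j < 2n matter, since 3^(floor (j / 2)) divides
   the j-th one. *)
Definition G (u z : Z3) : Z3 := MkZ3 (G_subproof u z).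

Lemma G_residue u z n N : (n.*2 <= N)%N ->
  G u z n = (\sum_(j < N) Gterm u z j) n.
Proof.
by move=> leN; rewrite -(residue_mod (\sum_(j < N) _) (leqnn n)) sum_Gterm_residue.
Qed.

(** For j >= 2 the coefficient d_j is divisible by 3; [K] collects these terms after division by 3.
    It depends on [n] because level [n.+1] uses 2n + 2 terms, the first two being split off. *)
Lemma G_expansion : exists K : nat -> Z3 -> Z3 -> Z3,
  (forall n (u u' z z' : Z3), u n = u' n -> z n = z' n ->
     K n u z n = K n u' z' n) /\
  forall n u z, G u z n.+1 = (1 + u * (z - 2) + 3 * K n u z) n.+1.
Proof.
have /choice[c cE] j : exists t, Gcoef (j + 2) = 3 * t.
  have [t ->] := Gcoef_dvd (j + 2); exists (3 ^+ j./2 * t).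
  by rewrite (_ : (j + 2)./2 = j./2.+1) ?exprS ?mulrA //; lia.
exists (fun n u z => \sum_(j < n.*2)
  c j * u ^+ (j + 2) * \prod_(i < j + 2) (z - 2 - i%:R)); split.
  move=> n u u' z z' eu ez.
  apply: (@eqr_sum (fun j => c j * u ^+ (j + 2) * \prod_(i < j + 2) (z - 2 - i%:R))
            (fun j => c j * u' ^+ (j + 2) * \prod_(i < j + 2) (z' - 2 - i%:R))).
  move=> j _; apply: eqrM; first by apply: eqrM => //; exact: eqrX.
  apply: (@eqr_prod (fun i => z - 2 - i%:R) (fun i => z' - 2 - i%:R)) => i _.
  by apply: eqrD => //; exact: eqrD.
move=> n u z; rewrite (@G_residue u z n.+1 _ (leqnn _)); congr (residue _ _).
rewrite doubleS !big_ord_recl /=.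
rewrite addrA; congr (_ + _).
  rewrite /Gterm /bump /= Gcoef0 Gcoef1 big_ord0 big_ord_recl big_ord0 /=.
  by rewrite subr0 expr1; ring.
rewrite mulr_sumr; apply: eq_bigr => j _.
by rewrite /Gterm /bump /= !add1n -addn2 cE; ring.
Qed.

Lemma G_eq n (u u' z z' : Z3) : u n = u' n -> z n = z' n -> G u z n = G u' z' n.
Proof.
have [K [cK GK]] := G_expansion.
case: n => [|n] eu ez; first by rewrite !residue_level0.
rewrite !GK; apply: eqrD.
  by apply: eqrD => //; apply: eqrM => //; exact: eqrD.
by apply/eqrM3/cK; [exact: residue_le eu | exact: residue_le ez].
Qed.

Lemma G_residue1 u z : G u z 1 = (1 + u * (z - 2)) 1%N.
Proof.
have [K [_ ->]] := G_expansion; rewrite -[X in _ = residue X _]addr0.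
by apply: eqrD => //; rewrite -(mulr0 3); apply: eqrM3; rewrite !residue_level0.
Qed.

(** * Roots of G in either variable *)

Lemma G_root_z (u : Z3) : u 1%N <> 0%N -> exists! z, G u z = 0.
Proof.
move=> /unit_sign[e [e2 /residue_dvdP[t uE]]].
have [K [cK GK]] := G_expansion.
apply: (hensel _ e) => // n x y exy.
(* With u = e + 3t, subtracting e w leaves [w] only under a factor 3, which gains the level that
   [hensel] requires. *)
have GE w : (G u w - e * w) n.+1 = (1 - 2 * u + 3 * (t * w + K n u w)) n.+1.
  rewrite [RHS](_ : _ = (1 + u * (w - 2) + 3 * K n u w - e * w) n.+1).
    by apply: eqrD => //; exact: GK.
  by congr (residue _ _); rewrite uE; ring.
rewrite !GE; apply: eqrD => //; apply: eqrM3; apply: eqrD; first exact: eqrM.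
exact: cK.
Qed.

Lemma G_root_u (z : Z3) : (z - 2) 1%N <> 0%N -> exists! u, G u z = 0.
Proof.
move=> /unit_sign[e [e2 /residue_dvdP[t zE]]].
have [K [cK GK]] := G_expansion.
apply: (hensel (fun u => G u z) e) => // n x y exy.
have GE w : (G w z - e * w) n.+1 = (1 + 3 * (t * w + K n w z)) n.+1.
  rewrite [RHS](_ : _ = (1 + w * (z - 2) + 3 * K n w z - e * w) n.+1).
    by apply: eqrD => //; exact: GK.
  by congr (residue _ _); rewrite zE; ring.
rewrite !GE; apply: eqrD => //; apply: eqrM3; apply: eqrD; first exact: eqrM.
exact: cK.
Qed.

(** * Binomial expansion of iota_q *)

Lemma prod_natr_sub (R : comPzRingType) (n j : nat) :
  \prod_(i < j) (n%:R - i%:R) = (n ^_ j)%:R :> R.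
Proof.
elim: j => [|j IHj]; first by rewrite big_ord0.
rewrite big_ord_recr /= IHj ffactnSr natrM.
have [lejn|ltnj] := leqP j n; first by rewrite natrB.
by rewrite ffact_small // !mul0r.
Qed.

(** Both sides are ((1 + r)^n - 1) / r; induction with Pascal's rule avoids the division. *)
Lemma geometric_sum_binomial (R : comPzRingType) (r : R) n :
  \sum_(i < n) (1 + r) ^+ i = \sum_(k < n) r ^+ k *+ 'C(n, k.+1).
Proof.
elim: n => [|n IHn]; first by rewrite !big_ord0.
rewrite big_ord_recr /= IHn addrC exprDn.
under [X in X + _]eq_bigr do rewrite expr1n mul1r.
have -> : \sum_(k < n) r ^+ k *+ 'C(n, k.+1) = \sum_(k < n.+1) r ^+ k *+ 'C(n, k.+1).
  by rewrite big_ord_recr /= bin_small // mulr0n addr0.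
rewrite -big_split /=.
by apply: eq_bigr => k _; rewrite binS mulrnDr addrC.
Qed.

(** For j > n the product in the [j]-th term contains the factor n - n, so the series is finite. *)
Lemma G_nat u n : G u n.+2%:R = \sum_(j < n.+1) Gterm u n.+2%:R j.
Proof.
apply: Z3P => m; rewrite (@G_residue u _ m (n.+1 + m.*2)) ?leq_addl //.
congr (residue _ _).
rewrite big_split_ord /= [X in _ + X]big1 ?addr0 // => j _.
rewrite /Gterm -(addn2 n) natrD addrK prod_natr_sub ffact_small ?mulr0 //.
exact: leq_addr.
Qed.

(** By uniqueness of the continuous interpolation, it suffices that the right-hand side is
    continuous and has the prescribed values at natural numbers. *)
Lemma iota_qE (h u z : Z3) : 2 * h = 1 ->
  iota_q (1 + 3 * u) z = z + h * (z * (z - 1)) * (3 * u) * G u z.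
Proof.
move=> h2.
pose f (z : Z3) := z + h * (z * (z - 1)) * (3 * u) * G u z.
have Uq : U 1 (1 + 3 * u) by exists u; rewrite ?expr1.
suff fP : q_interpolation (1 + 3 * u) f by rewrite ((iota_q_unique Uq).2 _ fP).
split.
  apply/continuousZ3P => x n; exists n => y eyx; apply: eqrD => //.
  apply: eqrM; last exact: G_eq.
  apply: eqrM => //; apply: eqrM => //; apply: eqrM => //; exact: eqrD.
move=> n; rewrite geometric_sum_binomial /f.
(* At 0 and 1 the factor z (z - 1) vanishes; [G_nat] covers the remaining values. *)
case: n => [|[|n]]; first by rewrite big_ord0 mul0r mulr0 !mul0r addr0.
  by rewrite subrr !mulr0 !mul0r addr0 big_ord_recl big_ord0 addr0.
rewrite big_ord_recl /= expr0 bin1; congr (_ + _).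
rewrite G_nat mulr_sumr; apply: eq_bigr => j _.
rewrite /Gterm /bump add1n -(addn2 n) natrD addrK prod_natr_sub -natrD.
have -> : (n + 2)%:R * ((n + 2)%:R - 1) =
    ((n + 2) * (n + 1))%:R :> Z3.
  by rewrite natrM !natrD; ring.
(* Both sides are the falling factorial of n + 2 of length j + 2; its factor (j + 2)! cancels the
   denominator of d_j. *)
have nE : ((n + 2) * (n + 1) * n ^_ j)%N = ((j + 2)`! * 'C(n + 2, j.+2))%N.
  by rewrite [RHS]mulnC !addn2 bin_ffact !ffactSS addn1 mulnA.
transitivity (h * (3 * u) * u ^+ j * Gcoef j * ((n + 2) * (n + 1) * n ^_ j)%N%:R).
  by rewrite !natrM; ring.
rewrite nE natrM.
transitivity (h * (3 * u) * u ^+ j * (Gcoef j * ((j + 2)`!)%:R) * ('C(n + 2, j.+2))%:R).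
  by ring.
rewrite GcoefE -[RHS]mulr_natr; transitivity
  (2 * h * ((3 * u) * (3 ^+ j * u ^+ j)) * ('C(n + 2, j.+2))%:R); first by ring.
by rewrite h2 mul1r -exprMn -exprS.
Qed.

(** * Fixed points as roots of G *)

Lemma nontrivial_fixed_pointP (u z : Z3) : u 1%N <> 0%N ->
  nontrivial_fixed_point (1 + 3 * u) z <-> [/\ G u z = 0, z <> 0 & z <> 1].
Proof.
move=> u1; have [h h2] := half_exists.
have u0 : u <> 0 by move=> uE; apply: u1; rewrite uE residue0.
rewrite /nontrivial_fixed_point /fixed_point (iota_qE h) //.
split=> -[gz z0 z1]; split=> //; last by rewrite gz mulr0 addr0.
apply: (@Z3_mulI (z - 1)); last by move=> /eqP; rewrite subr_eq0 => /eqP.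
apply: (@Z3_mulI z) => //; apply: (@Z3_mulI u) => //; apply: mul3_eq0.
transitivity (2 * h * (3 * (u * (z * ((z - 1) * G u z))))).
  by rewrite h2 mul1r.
transitivity (2 * (z + h * (z * (z - 1)) * (3 * u) * G u z - z)); first by ring.
by rewrite gz subrr mulr0.
Qed.

(** * Classes of q modulo 9 and residues of u modulo 3 *)

Lemma coset_1D3 (u a : Z3) : coset (1 + 3 * a) (3 ^+ 2) (1 + 3 * u) <-> u 1%N = a 1%N.
Proof.
split=> [/coset_residue/residue_dvdP[t ut]|/eqrM3 ua].
  apply/residue_dvdP; exists t; apply/eqP; rewrite -subr_eq0; apply/eqP/mul3_eq0.
  have -> : 3 * (u - (a + 3 ^+ 1 * t)) = 1 + 3 * u - (1 + 3 * a + 3 ^+ 2 * t) by ring.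
  by rewrite ut subrr.
by apply/coset_residue; apply: eqrD.
Qed.

Lemma nine_expr : 9 = 3 ^+ 2 :> Z3.
Proof. by ring. Qed.

Lemma coset7P (u : Z3) : coset 7 9 (1 + 3 * u) <-> u 1%N = 2%N.
Proof.
have -> : 7 = 1 + 3 * 2 :> Z3 by ring.
by rewrite nine_expr coset_1D3 residue_nat.
Qed.

Lemma coset4P (u : Z3) : coset 4 9 (1 + 3 * u) <-> u 1%N = 1%N.
Proof.
have -> : 4 = 1 + 3 * 1 :> Z3 by ring.
by rewrite nine_expr coset_1D3 (residue_nat 1).
Qed.

Lemma UD_U2P (q : Z3) :
  (U 1 `\` U 2) q <-> exists u : Z3, q = 1 + 3 * u /\ u 1%N <> 0%N.
Proof.
have U2P u : U 2 (1 + 3 * u) <-> u 1%N = 0%N.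
  by have := coset_1D3 u 0; rewrite mulr0 addr0 residue0.
split=> [[[u _ <-] nU2]|[u [-> u1]]].
  by exists u; rewrite expr1 in nU2 *; split=> // u1; apply: nU2; exact/U2P.
by split; [exists u; rewrite ?expr1 | move/U2P].
Qed.

(** * Location of the root and the exceptional parameters *)

Lemma G_root_residue1 (u z : Z3) : G u z = 0 ->
  (u 1%N = 1%N -> z 1%N = 1%N) /\ (u 1%N = 2%N -> z 1%N = 0%N).
Proof.
move=> gz; have := G_residue1 u z; rewrite gz residue0 => e1.
(* Replacing -2 by 1 modulo 3 makes the residues computable as natural numbers. *)
have : (1 + u * (z + 1)) 1%N = 0%N.
  apply: etrans (esym e1); apply: eqrD => //; apply: eqrM => //; exact: eqrD.
rewrite residueD residueM residueD !(residue_nat 1) expn1.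
have := residue_lt z 1; case: (z 1%N) => [|[|[|]]] // _ uz; by split=> u1; move: uz; rewrite u1.
Qed.

Lemma G_root_unique (u z : Z3) : u 1%N <> 0%N -> G u z = 0 ->
  forall z', G u z' = 0 -> z' = z.
Proof.
by move=> /G_root_z[w [_ wU]] /wU <- z' /wU <-.
Qed.

Lemma no_nontrivialP (u z : Z3) : u 1%N <> 0%N -> G u z = 0 ->
  (~ exists z', nontrivial_fixed_point (1 + 3 * u) z') <-> z = 0 \/ z = 1.
Proof.
move=> u1 gz; split=> [nz|z01 [z' /(nontrivial_fixed_pointP _ _ u1)[gz' z0 z1]]].
  apply: contrapT => /not_orP[z0 z1]; apply: nz; exists z.
  exact/nontrivial_fixed_pointP.
by move: z01; rewrite -(G_root_unique _ _ u1 gz _ gz'); case.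
Qed.

Theorem mainTheorem1 :
  exists q0 q1 : Z3,
  [/\ unique (fun q : Z3 => [/\ (U 1 `\` U 2) q, coset 7 9 q &
        ~ exists z : Z3, nontrivial_fixed_point q z]) q0,
      unique (fun q : Z3 => [/\ (U 1 `\` U 2) q, coset 4 9 q &
        ~ exists z : Z3, nontrivial_fixed_point q z]) q1 &
      forall q : Z3, (U 1 `\` U 2) q -> q <> q0 -> q <> q1 ->
        exists2 z : Z3, unique (nontrivial_fixed_point q) z &
          (coset 4 9 q -> coset 1 3 z) /\ (coset 7 9 q -> coset 0 3 z)].
Proof.
have [|u0 [g0 u0U]] := G_root_u 0; first by [].
have [|u1 [g1 u1U]] := G_root_u 1; first by [].
have u0E : u0 1%N = 2%N.
  have := residue_lt u0 1; have := G_residue1 u0 0; rewrite g0 residue0.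
  by rewrite residueD residueM (residue_nat 1); case: (u0 1%N) => [|[|[|]]].
have u1E : u1 1%N = 1%N.
  have := residue_lt u1 1; have := G_residue1 u1 1; rewrite g1 residue0.
  by rewrite residueD residueM (residue_nat 1); case: (u1 1%N) => [|[|[|]]].
exists (1 + 3 * u0), (1 + 3 * u1); split.
- split=> [|q [/UD_U2P[u [-> un0]] /coset7P u2]].
    split; [by apply/UD_U2P; exists u0; rewrite u0E | exact/coset7P |].
    by apply/(no_nontrivialP _ _ _ g0); [rewrite u0E | left].
  have [z [gz _]] := G_root_z _ un0; move=> /(no_nontrivialP _ _ un0 gz).
  have z1 := (G_root_residue1 _ _ gz).2 u2.
  (* Here u = 2 modulo 3 forces z = 0 modulo 3, so the root cannot be 1 and [u] must be [u0]. *)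
  case=> zE; last by move: z1; rewrite zE (residue_nat 1).
  by rewrite zE in gz; rewrite (u0U _ gz).
- split=> [|q [/UD_U2P[u [-> un0]] /coset4P u2]].
    split; [by apply/UD_U2P; exists u1; rewrite u1E | exact/coset4P |].
    by apply/(no_nontrivialP _ _ _ g1); [rewrite u1E | right].
  have [z [gz _]] := G_root_z _ un0; move=> /(no_nontrivialP _ _ un0 gz).
  have z1 := (G_root_residue1 _ _ gz).1 u2.
  case=> zE; first by move: z1; rewrite zE residue0.
  by rewrite zE in gz; rewrite (u1U _ gz).
move=> q /UD_U2P[u [-> un0]] q0 q1.
have [z [gz zU]] := G_root_z _ un0; have [zl zr] := G_root_residue1 _ _ gz.
exists z; last first.
  split=> [/coset4P/zl|/coset7P/zr] z1; rewrite -[3]expr1; apply/coset_residue.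
    by rewrite z1 (residue_nat 1).
  by rewrite z1 residue0.
split=> [|z' /(nontrivial_fixed_pointP _ _ un0)[/zU]//].
(* A root equal to 0 or 1 would force [u] to be [u0] or [u1], the excluded parameters. *)
apply/nontrivial_fixed_pointP => //; split=> // zE.
  by apply: q0; rewrite zE in gz; rewrite (u0U _ gz).
by apply: q1; rewrite zE in gz; rewrite (u1U _ gz).
Qed.
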